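(* Let $(A, d_1, \ldots, d_N)$ be an AssHDer pair of rank $N$. If $H^3_{\mathrm{AssHDer}}(A, A) = 0$, then every finite order deformation of $(A, d_1, \ldots, d_N)$ is extensible.
   Context: All vector spaces and linear maps are over a field $\mathbb{K}$ of characteristic zero. Algebras are associative, not assumed unital. Fix an integer $N \ge 1$. A higher derivation of rank $N$ on an associative algebra $A$ is a sequence $\{d_1, \ldots, d_N\}$ of linear maps $A \to A$ with $d_k(ab) = \sum_{i+j=k} d_i(a) d_j(b)$ for $1 \le k \le N$, $a,b\in A$, where $i,j\ge 0$ and $d_0 = \mathrm{id}_A$. An AssHDer pair of rank $N$ is a tuple $(A, d_1, \ldots, d_N)$ of an associative algebra and a higher derivation of rank $N$ on it. Write $\mu$ for the multiplication of $A$. Cohomology with coefficients in itself ($M = A$ with its own multiplication as bimodule actions and $d_k^M = d_k$). For $f \in \mathrm{Hom}(A^{\otimes n}, A)$, $n\ge 1$, $\delta_{\mathrm{Hoch}} f$ is the Hochschild coboundary $(\delta_{\mathrm{Hoch}} f)(a_1, \ldots, a_{n+1}) = a_1 f(a_2, \ldots, a_{n+1}) + \sum_{i=1}^n (-1)^i f(a_1, \ldots, a_i a_{i+1}, \ldots, a_{n+1}) + (-1)^{n+1} f(a_1, \ldots, a_n) a_{n+1}$, and $\delta_k f = \sum_{i_1 + \cdots + i_n = k,\ i_l\ge 0} f \circ (d_{i_1} \otimes \cdots \otimes d_{i_n}) - d_k \circ f$ for $1\le k\le N$. For a tuple $(f_1, \ldots, f_N)$ in $\mathrm{Hom}(A^{\otimes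 n}, A)$ and $1\le k\le N$, $\delta'_{\mathrm{Hoch}}(f_k)(a_1, \ldots, a_{n+1}) = \sum_{i+j=k,\ i \ge 0,\ j \ge 1} d_i(a_1) f_j(a_2, \ldots, a_{n+1}) + \sum_{i=1}^n (-1)^i f_k(a_1, \ldots, a_i a_{i+1}, \ldots, a_{n+1}) + (-1)^{n+1} \sum_{i+j=k,\ i \ge 1,\ j \ge 0} f_i(a_1, \ldots, a_n) d_j(a_{n+1})$. Set $C^0_{\mathrm{AssHDer}}(A,A) = 0$, $C^1_{\mathrm{AssHDer}}(A, A) = \mathrm{Hom}(A, A)$, and $C^n_{\mathrm{AssHDer}}(A, A) = \mathrm{Hom}(A^{\otimes n}, A) \times \mathrm{Hom}(A^{\otimes n-1}, A)^{N}$ for $n \ge 2$. The differential is $\partial f = (\delta_{\mathrm{Hoch}} f; -\delta_1 f, \ldots, -\delta_N f)$ for $f\in C^1$, and $\partial(f; f_1, \ldots, f_N) = (\delta_{\mathrm{Hoch}} f; \delta'_{\mathrm{Hoch}} f_1 + (-1)^n \delta_1 f, \ldots, \delta'_{\mathrm{Hoch}} f_N + (-1)^n \delta_N f)$ for $(f; f_1, \ldots, f_N) \in C^n$, $n \ge 2$. $H^\ast_{\mathrm{AssHDer}}(A, A)$ is the cohomology of this complex. A deformation of order $n$ of $(A, d_1, \ldots, d_N)$ consists of sums $\mu_t = \sum_{i=0}^n t^i \mu_i$, $d_{k,t} = \sum_{i=0}^n t^i d_{k,i}$ ($1\le k\le N$), with $\mu_i \in \mathrm{Hom}(A^{\otimes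 2}, A)$, $d_{k,i} \in \mathrm{Hom}(A,A)$, $\mu_0 = \mu$, $d_{k,0} = d_k$, such that $(A[[t]]/(t^{n+1}), \mu_t, d_{1,t}, \ldots, d_{N,t})$ is an AssHDer pair over $\mathbb{K}[[t]]/(t^{n+1})$. A finite order deformation is a deformation of order $n$ for some $n$. A deformation of order $n$ is extensible if there exists $(\mu_{n+1}; d_{1,n+1}, \ldots, d_{N,n+1}) \in C^2_{\mathrm{AssHDer}}(A,A)$ such that $(\mu_t + t^{n+1}\mu_{n+1}; d_{1,t} + t^{n+1} d_{1,n+1}, \ldots, d_{N,t} + t^{n+1} d_{N,n+1})$ is a deformation of order $n+1$. *)

(* Defs.v *)
From HB Require Import structures.
From mathcomp Require Import all_boot all_order all_algebra.

Set Implicit Arguments.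
Unset Strict Implicit.
Unset Printing Implicit Defensive.

Import GRing.Theory.
Local Open Scope ring_scope.

Notation is_bilinear f := (bilinear_for *:%R *:%R f).

(* A sequence (d_1, ..., d_N) is a family d indexed by 'I_N, d k standing for
   d_(k+1); [der0 d] prepends d_0 = id, so that [der0 d i] is d_i for i <= N. *)
Definition der0 (A : Type) (N : nat) (d : 'I_N -> A -> A) (i : 'I_N.+1) :
    A -> A :=
  if unlift ord0 i is Some k then d k else id.

(* The base ring is arbitrary because deformations are pairs over
   K[[t]]/(t^(n+1)). The algebra need not be unital, hence is given by a bare
   module and a bilinear product. *)
Record AssHDer_pair (R : comNzRingType) (A : lmodType R) (N : nat)
    (mu : A -> A -> A) (d : 'I_N -> A -> A) : Prop := {
  mul_bilinear : is_bilinear mu;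
  mul_assoc : associative mu;
  der_linear : forall k, linear (d k);
  der_mul : forall (k : 'I_N) (a b : A),
    d k (mu a b) =
      \sum_(ij : 'I_N.+1 * 'I_N.+1 | (ij.1 + ij.2)%N == k.+1)
         mu (der0 d ij.1 a) (der0 d ij.2 b)
}.

Section Cohomology.

Variables (K : fieldType) (A : lmodType K) (N : nat).
Variables (mu : A -> A -> A) (d : 'I_N -> A -> A).

Definition nfun (n : nat) : Type := {ffun 'I_n -> A} -> A.

(* The elements of Hom(A^{(x) n}, A). *)
Definition multilinear (n : nat) (f : nfun n) : Prop :=
  forall (a : {ffun 'I_n -> A}) (i : 'I_n),
    linear (fun x => f [ffun j => if j == i then x else a j]).

(* (a_1, ..., a_(n+1)) |-> (a_2, ..., a_(n+1)) *)
Definition args_behead n (a : {ffun 'I_n.+1 -> A}) : {ffun 'I_n -> A} :=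
  [ffun j => a (lift ord0 j)].

(* (a_1, ..., a_(n+1)) |-> (a_1, ..., a_n) *)
Definition args_belast n (a : {ffun 'I_n.+1 -> A}) : {ffun 'I_n -> A} :=
  [ffun j => a (lift ord_max j)].

(* (a_1, ..., a_(n+1)) |-> (a_1, ..., a_i a_(i+1), ..., a_(n+1)); the
   factors are counted from 1 here, so the ordinal below is i - 1. *)
Definition args_mul n (i : 'I_n) (a : {ffun 'I_n.+1 -> A}) :
    {ffun 'I_n -> A} :=
  [ffun j : 'I_n =>
     if (j < i)%N then a (lift ord_max j)
     else if j == i then mu (a (lift ord_max j)) (a (lift ord0 j))
     else a (lift ord0 j)].

Definition delta_Hoch n (f : nfun n) : nfun n.+1 := fun a =>
  mu (a ord0) (f (args_behead a))
  + \sum_(i < n) (-1) ^+ i.+1 *: f (args_mul i a)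
  + (-1) ^+ n.+1 *: mu (f (args_belast a)) (a ord_max).

(* The operator delta_(k+1). *)
Definition delta (k : 'I_N) n (f : nfun n) : nfun n := fun a =>
  \sum_(i : {ffun 'I_n -> 'I_N.+1} | (\sum_l i l)%N == k.+1)
     f [ffun l => der0 d (i l) (a l)]
  - d k (f a).

(* delta'_Hoch (f_(k+1)); it depends on the whole tuple (f_1, ..., f_N). *)
Definition delta'_Hoch n (f : 'I_N -> nfun n) (k : 'I_N) : nfun n.+1 := fun a =>
  \sum_(ij : 'I_N.+1 * 'I_N | (ij.1 + ij.2.+1)%N == k.+1)
     mu (der0 d ij.1 (a ord0)) (f ij.2 (args_behead a))
  + \sum_(i < n) (-1) ^+ i.+1 *: f k (args_mul i a)
  + (-1) ^+ n.+1 *: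
    \sum_(ij : 'I_N * 'I_N.+1 | (ij.1.+1 + ij.2)%N == k.+1)
       mu (f ij.1 (args_belast a)) (der0 d ij.2 (a ord_max)).

(* C^n_AssHDer(A, A) is the part of [precochain n] cut out by [cochain]; its
   elements are compared by [eq_cochain]. *)
Definition precochain (n : nat) : Type :=
  match n with
  | 0 => unit
  | 1 => nfun 1
  | m.+2 => (nfun m.+2 * ('I_N -> nfun m.+1))%type
  end.

Definition cochain (n : nat) : precochain n -> Prop :=
  match n with
  | 0 => fun _ => True
  | 1 => fun f => multilinear f
  | m.+2 => fun c => multilinear c.1 /\ forall k, multilinear (c.2 k)
  end.

Definition eq_cochain (n : nat) : precochain n -> precochain n -> Prop :=
  match n with
  | 0 => fun _ _ => True
  | 1 => fun f g => f =1 g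
  | m.+2 => fun c e => c.1 =1 e.1 /\ forall k, c.2 k =1 e.2 k
  end.

Definition cochain0 (n : nat) : precochain n :=
  match n with
  | 0 => tt
  | 1 => fun _ => 0
  | m.+2 => (fun _ => 0, fun _ _ => 0)
  end.

Definition differential (n : nat) : precochain n -> precochain n.+1 :=
  match n with
  | 0 => fun _ => cochain0 1
  | 1 => fun f => (delta_Hoch f, fun k a => - delta k f a)
  | m.+2 => fun c =>
      (delta_Hoch c.1,
       fun k a => delta'_Hoch c.2 k a + (-1) ^+ m.+2 *: delta k c.1 a)
  end.

Definition cocycle (n : nat) (c : precochain n) : Prop :=
  cochain c /\ eq_cochain (differential c) (cochain0 n.+1).

Definition coboundary (n : nat) : precochain n -> Prop :=
  match n with
  | 0 => fun c => eq_cochain c (cochain0 0)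
  | m.+1 => fun c =>
      exists b : precochain m, cochain b /\ eq_cochain c (differential b)
  end.

(* H^n_AssHDer(A, A) = 0 *)
Definition cohomology_vanishes (n : nat) : Prop :=
  forall c : precochain n, cocycle c -> coboundary c.

End Cohomology.

Section TruncatedSeries.

Variables (K : fieldType) (A : lmodType K) (n : nat).

Definition tring : comNzRingType := {poly %/ ('X^(n.+1) : {poly K})}.

(* A[[t]]/(t^(n+1)): the series \sum_(i <= n) t^i a_i is the family of its
   coefficients. It carries the structure of a module over K[[t]]/(t^(n+1)). *)
Definition tseries : Type := {ffun 'I_n.+1 -> A}.

HB.instance Definition _ := GRing.Zmodule.on tseries.

Definition tscale (c : tring) (a : tseries) : tseries :=
  [ffun m : 'I_n.+1 => \sum_(ij : 'I_n.+1 * 'I_n.+1 | (ij.1 + ij.2)%N == m)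
     (c : {poly K})`_ij.1 *: a ij.2].

Lemma sum_conv (V : zmodType) (i : 'I_n.+1) (x : nat) (G : 'I_n.+1 * 'I_n.+1 -> V) :
  \sum_(l : 'I_n.+1 | (x + l)%N == i)
     \sum_(p : 'I_n.+1 * 'I_n.+1 | (p.1 + p.2)%N == l) G p
  = \sum_(p : 'I_n.+1 * 'I_n.+1 | (x + (p.1 + p.2))%N == i) G p.
Proof.
rewrite (exchange_big_dep
  (fun p : 'I_n.+1 * 'I_n.+1 => (x + (p.1 + p.2))%N == i)) /=; last first.
  by move=> l p /eqP Hl /eqP ->; rewrite Hl.
apply: eq_bigr => p /eqP Hp.
have Hl : (p.1 + p.2 < n.+1)%N.
  by apply: leq_ltn_trans (ltn_ord i); rewrite -Hp leq_addl.
rewrite (big_pred1 (Ordinal Hl)) // => l; rewrite /= -val_eqE /= [RHS]eq_sym.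
have [<-|] := (p.1 + p.2)%N =P l; last by rewrite andbF.
by rewrite Hp eqxx.
Qed.

Lemma coef_tringM (c e : tring) (m : 'I_n.+1) :
  ((c * e : tring) : {poly K})`_m =
  \sum_(ij : 'I_n.+1 * 'I_n.+1 | (ij.1 + ij.2)%N == m)
     (c : {poly K})`_ij.1 * (e : {poly K})`_ij.2.
Proof.
have rmodE (p : {poly K}) :
    Pdiv.Ring.rmodp p (mk_monic 'X^(n.+1)) = Pdiv.Ring.rmodp p 'X^(n.+1).
  by rewrite mk_monic_Xn.
have -> : ((c * e : tring) : {poly K}) =
    Pdiv.Ring.rmodp ((c : {poly K}) * e) 'X^(n.+1) by exact: rmodE.
have -> : (Pdiv.Ring.rmodp ((c : {poly K}) * e) 'X^(n.+1))`_m
    = ((c : {poly K}) * e)`_m.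
  rewrite {2}(Pdiv.RingMonic.rdivp_eq (monicXn K n.+1) ((c : {poly K}) * e)).
  by rewrite coefD coefMXn ltn_ord add0r.
rewrite coefM.
rewrite (eq_bigl (fun ij : 'I_n.+1 * 'I_n.+1 =>
   true && ((ij.1 + ij.2)%N == m))) //.
rewrite -(pair_big_dep xpredT (fun i j : 'I_n.+1 => (i + j)%N == m)
   (fun i j => (c : {poly K})`_i * (e : {poly K})`_j)) /=.
rewrite (big_ord_widen n.+1 (fun j => (c : {poly K})`_j *
   (e : {poly K})`_(m - j))) // big_mkcond /=.
apply: eq_bigr => j _; rewrite ltnS; case: leqP => Hj; last first.
  by rewrite big1 // => k /eqP Hk; move: Hj; rewrite -Hk ltnNge leq_addr.
have Hl : (m - j < n.+1)%N by apply: leq_ltn_trans (ltn_ord m); rewrite leq_subr.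
rewrite (big_pred1 (Ordinal Hl)) // => k.
by rewrite -[in LHS](subnKC Hj) eqn_add2l.
Qed.

Lemma sum_pairE (V : zmodType) (P : 'I_n.+1 -> 'I_n.+1 -> bool)
    (F : 'I_n.+1 -> 'I_n.+1 -> V) :
  \sum_(ij : 'I_n.+1 * 'I_n.+1 | P ij.1 ij.2) F ij.1 ij.2
  = \sum_i \sum_(j | P i j) F i j.
Proof. by rewrite pair_big_dep. Qed.

Fact tscaleA (c e : tring) (a : tseries) :
  tscale c (tscale e a) = tscale (c * e) a.
Proof.
apply/ffunP => m; rewrite !ffunE.
transitivity (\sum_(j : 'I_n.+1) \sum_(p : 'I_n.+1 * 'I_n.+1 |
   (j + (p.1 + p.2))%N == m)
     ((c : {poly K})`_j * (e : {poly K})`_p.1) *: a p.2).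
  rewrite (sum_pairE (fun i j : 'I_n.+1 => (i + j)%N == m)
     (fun i j => (c : {poly K})`_i *: (tscale e a) j)).
  apply: eq_bigr => j _; rewrite -sum_conv; apply: eq_bigr => l _.
  rewrite ffunE scaler_sumr; apply: eq_bigr => p _; exact: scalerA.
transitivity (\sum_(l : 'I_n.+1) \sum_(p : 'I_n.+1 * 'I_n.+1 |
   (l + (p.1 + p.2))%N == m)
     ((c : {poly K})`_p.1 * (e : {poly K})`_p.2) *: a l).
  rewrite (eq_bigr (fun j : 'I_n.+1 => \sum_(k : 'I_n.+1) \sum_(l : 'I_n.+1 |
     (j + (k + l))%N == m) ((c : {poly K})`_j * (e : {poly K})`_k) *: a l));
    last by move=> j _; rewrite pair_big_dep.
  rewrite [RHS](eq_bigr (fun l : 'I_n.+1 => \sum_(j : 'I_n.+1) \sum_(k : 'I_n.+1 |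
     (l + (j + k))%N == m) ((c : {poly K})`_j * (e : {poly K})`_k) *: a l));
    last by move=> l _; rewrite pair_big_dep.
  rewrite [RHS]exchange_big /=; apply: eq_bigr => j _.
  rewrite (exchange_big_dep xpredT) //= ; apply: eq_bigr => l _.
  by apply: eq_bigl => k; rewrite addnA addnC.
rewrite [RHS](sum_pairE (fun i j : 'I_n.+1 => (i + j)%N == m)
   (fun i j => ((c * e : tring) : {poly K})`_i *: a j)).
rewrite [RHS](exchange_big_dep xpredT) //=; apply: eq_bigr => l _.
rewrite -sum_conv; apply: eq_big => [j|j _]; first by rewrite addnC.
by rewrite coef_tringM scaler_suml.
Qed.

Fact tscale1 : left_id 1 tscale.
Proof.
move=> a; apply/ffunP => m; rewrite ffunE.
rewrite (bigD1 (ord0, m)) //= coef1 eqxx scale1r big1 ?addr0 //.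
move=> [i j] /= /andP[/eqP Hij Hn]; rewrite coef1.
case: eqP => [Hi|]; last by rewrite scale0r.
case/eqP: Hn; congr (_, _); apply: val_inj => //=.
by rewrite -Hij Hi.
Qed.

Fact tscaleDr : right_distributive tscale +%R.
Proof.
move=> c a b; apply/ffunP => m; rewrite !ffunE -big_split /=.
by apply: eq_bigr => ij _; rewrite ffunE scalerDr.
Qed.

Fact tscaleDl (a : tseries) : {morph tscale^~ a : c e / c + e}.
Proof.
move=> c e; apply/ffunP => m; rewrite !ffunE -big_split /=.
by apply: eq_bigr => ij _; rewrite coefD scalerDl.
Qed.

HB.instance Definition _ := GRing.Zmodule_isLmodule.Build tring tseries
  tscaleA tscale1 tscaleDr tscaleDl.

(* The K[[t]]/(t^(n+1))-bilinear extension of mu_t = \sum_i t^i mu_i. *)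
Definition tmul (mut : 'I_n.+1 -> A -> A -> A) (a b : tseries) : tseries :=
  [ffun m : 'I_n.+1 => \sum_(ijl : 'I_n.+1 * 'I_n.+1 * 'I_n.+1
                   | (ijl.1.1 + ijl.1.2 + ijl.2)%N == m)
     mut ijl.1.1 (a ijl.1.2) (b ijl.2)].

(* The K[[t]]/(t^(n+1))-linear extension of f_t = \sum_i t^i f_i. *)
Definition tmap (ft : 'I_n.+1 -> A -> A) (a : tseries) : tseries :=
  [ffun m : 'I_n.+1 => \sum_(ij : 'I_n.+1 * 'I_n.+1 | (ij.1 + ij.2)%N == m)
     ft ij.1 (a ij.2)].

End TruncatedSeries.

Section Deformation.

Variables (K : fieldType) (A : lmodType K) (N : nat).
Variables (mu : A -> A -> A) (d : 'I_N -> A -> A).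

(* A deformation of order n, given by the coefficients mut i = mu_i and
   dt k i = d_(k+1, i) for i <= n. *)
Record deformation (n : nat) (mut : 'I_n.+1 -> A -> A -> A)
    (dt : 'I_N -> 'I_n.+1 -> A -> A) : Prop := {
  def_mul_bilinear : forall i, is_bilinear (mut i);
  def_der_linear : forall k i, linear (dt k i);
  def_mul0 : mut ord0 =2 mu;
  def_der0 : forall k, dt k ord0 =1 d k;
  def_pair : AssHDer_pair (R := tring K n) (A := tseries A n)
               (tmul mut) (fun k => tmap (dt k))
}.

(* Appends the coefficient of t^(n+1). *)
Definition extend (T : Type) (n : nat) (u : 'I_n.+1 -> T) (x : T)
    (i : 'I_n.+2) : T :=
  if unlift ord_max i is Some j then u j else x.

Definition extensible (n : nat) (mut : 'I_n.+1 -> A -> A -> A)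
    (dt : 'I_N -> 'I_n.+1 -> A -> A) : Prop :=
  exists (mu' : A -> A -> A) (d' : 'I_N -> A -> A),
    [/\ is_bilinear mu', forall k, linear (d' k)
      & deformation (extend mut mu') (fun k => extend (dt k) (d' k))].

End Deformation.

(* Main.v *)
(* Extend a deformation of order n by arbitrary coefficients of t^(n+1). The
   associator of the product and the defects of the Leibniz rules then lie in
   t^(n+1) A, because the deformation holds up to order n. These defects satisfy
   two identities valid for any bilinear product and any linear maps: the
   pentagon identity of the associator, and the identity expressing the
   delta'-coboundary of the Leibniz defects as the delta of the associator.
   Their coefficients of t^(n+1) say that the obstruction is a 3-cocycle.
   Changing the coefficients of t^(n+1) subtracts a coboundary from the
   obstruction, so when H^3 = 0 it can be removed. *)
Require Import Defs.
From HB Require Import structures.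
From mathcomp Require Import all_boot all_order all_algebra.

Set Implicit Arguments.
Unset Strict Implicit.
Unset Printing Implicit Defensive.

Import GRing.Theory.
Local Open Scope ring_scope.

(** * Associator and Leibniz defects *)

Lemma der0_0 (T : Type) (N : nat) (D : 'I_N -> T -> T) x : der0 D ord0 x = x.
Proof. by rewrite /der0 unlift_none. Qed.

Lemma der0_lift (T : Type) (N : nat) (D : 'I_N -> T -> T) k x :
  der0 D (lift ord0 k) x = D k x.
Proof. by rewrite /der0 liftK. Qed.

Lemma linear_at0 (R : pzRingType) (U V : lmodType R) (f : U -> V) :
  linear f -> f 0 = 0.
Proof.
by move=> f_lin; rewrite -(subrr 0) (zmod_morphism_linear f_lin) subrr.
Qed.

Lemma linear_atD (R : pzRingType) (U V : lmodType R) (f : U -> V) :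
  linear f -> {morph f : x y / x + y}.
Proof. by move=> f_lin x y; have := f_lin 1 x y; rewrite !scale1r. Qed.

Section Defects.

Variables (R : comNzRingType) (B : lmodType R) (N : nat).
Variables (m : B -> B -> B) (D : 'I_N -> B -> B).
Hypotheses (m_bilinear : is_bilinear m) (D_linear : forall k, linear (D k)).

HB.instance Definition _ :=
  bilinear_isBilinear.Build R B B B *:%R *:%R m m_bilinear.
HB.instance Definition _ k :=
  GRing.isLinear.Build R B B *:%R (D k) (D_linear k).

Definition associator (x y z : B) : B := m (m x y) z - m x (m y z).

(** The index starts at 0, where the defect vanishes by [leib0], so that convolutions over all pairs
    of indices can be formed. *)
Definition leib (i : 'I_N.+1) (x y : B) : B :=
  der0 D i (m x y) -
  \sum_(p : 'I_N.+1 * 'I_N.+1 | (p.1 + p.2)%N == i)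
     m (der0 D p.1 x) (der0 D p.2 y).

Lemma linear_der0 i : linear (der0 D i).
Proof.
move=> c x y; rewrite /der0; case: unlift => [k|//]; exact: linearP.
Qed.

Lemma leib0 x y : leib ord0 x y = 0.
Proof.
rewrite /leib (big_pred1 (ord0, ord0)) /=; first by rewrite !der0_0 subrr.
by move=> [i j]; rewrite /= addn_eq0 xpair_eqE -!val_eqE.
Qed.

Lemma associator_linear_l y z : linear (fun x => associator x y z).
Proof.
move=> c u v; rewrite /associator !(linearPl, linearPr) /=.
by rewrite scalerBr opprD addrACA.
Qed.

Lemma associator_linear_m x z : linear (fun y => associator x y z).
Proof.
move=> c u v; rewrite /associator !(linearPl, linearPr) /=.
by rewrite scalerBr opprD addrACA.
Qed.

Lemma associator_linear_r x y : linear (fun z => associator x y z).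
Proof.
move=> c u v; rewrite /associator !(linearPl, linearPr) /=.
by rewrite scalerBr opprD addrACA.
Qed.

Lemma leib_linear_l i y : linear (fun x => leib i x y).
Proof.
move=> c u v; rewrite /leib linearPl linear_der0 scalerBr addrACA -opprD.
congr (_ - _); rewrite scaler_sumr -big_split; apply: eq_bigr => p _.
by rewrite linear_der0 linearPl.
Qed.

Lemma leib_linear_r i x : linear (fun y => leib i x y).
Proof.
move=> c u v; rewrite /leib linearPr linear_der0 scalerBr addrACA -opprD.
congr (_ - _); rewrite scaler_sumr -big_split; apply: eq_bigr => p _.
by rewrite linear_der0 linearPr.
Qed.

(** Each of the five bracketings of four factors occurs twice, with opposite signs; the reordering
    in the proof makes the sum telescope around the pentagon. *)
Lemma associator_pentagon x y z t :
  m x (associator y z t) - associator (m x y) z t + associator x (m y z) t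
  - associator x y (m z t) + m (associator x y z) t = 0.
Proof.
rewrite /associator !(linearBl, linearBr) /=.
by rewrite !opprB [LHS](ACl (1*4*2*5*3)) /= !subrKA subrr.
Qed.

(** Nested pairs of indices merge into triples with total [i]. Here and in [sum_leib_l] the index of
    [x] is outermost, so that [leib_associator] can subtract the two triple sums term by term. *)
Lemma sum_leib_r x y z (i : 'I_N.+1) :
  \sum_(p : 'I_N.+1 * 'I_N.+1 | (p.1 + p.2)%N == i)
     m (der0 D p.1 x) (leib p.2 y z) =
  \sum_(p : 'I_N.+1 * 'I_N.+1 | (p.1 + p.2)%N == i)
     m (der0 D p.1 x) (der0 D p.2 (m y z))
  - \sum_(a : 'I_N.+1) \sum_(p : 'I_N.+1 * 'I_N.+1 | (a + (p.1 + p.2))%N == i)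
       m (der0 D a x) (m (der0 D p.1 y) (der0 D p.2 z)).
Proof.
rewrite /leib; under eq_bigr do rewrite linearBr /=.
rewrite sumrB; congr (_ - _).
rewrite (sum_pairE (fun a b : 'I_N.+1 => (a + b)%N == i) (fun a b =>
  m (der0 D a x) (\sum_(p : 'I_N.+1 * 'I_N.+1 | (p.1 + p.2)%N == b)
     m (der0 D p.1 y) (der0 D p.2 z)))).
apply: eq_bigr => a _; rewrite -sum_conv; apply: eq_bigr => b _.
by rewrite linear_sumr.
Qed.

Lemma sum_leib_l x y z (i : 'I_N.+1) :
  \sum_(p : 'I_N.+1 * 'I_N.+1 | (p.1 + p.2)%N == i)
     m (leib p.1 x y) (der0 D p.2 z) =
  \sum_(p : 'I_N.+1 * 'I_N.+1 | (p.1 + p.2)%N == i)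
     m (der0 D p.1 (m x y)) (der0 D p.2 z)
  - \sum_(a : 'I_N.+1) \sum_(p : 'I_N.+1 * 'I_N.+1 | (a + (p.1 + p.2))%N == i)
       m (m (der0 D a x) (der0 D p.1 y)) (der0 D p.2 z).
Proof.
rewrite /leib; under eq_bigr do rewrite linearBl /=.
rewrite sumrB; congr (_ - _).
rewrite (sum_pairE (fun a b : 'I_N.+1 => (a + b)%N == i) (fun a b =>
  m (\sum_(p : 'I_N.+1 * 'I_N.+1 | (p.1 + p.2)%N == a)
       m (der0 D p.1 x) (der0 D p.2 y)) (der0 D b z))).
(* Merging by [sum_conv] needs the index of [z] outermost; the exchanges that follow bring that of
   [x] to the front. *)
transitivity (\sum_(c : 'I_N.+1) \sum_(p : 'I_N.+1 * 'I_N.+1 |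
    (c + (p.1 + p.2))%N == i) m (m (der0 D p.1 x) (der0 D p.2 y)) (der0 D c z)).
  rewrite (exchange_big_dep xpredT) //=; apply: eq_bigr => c _.
  rewrite -sum_conv; apply: eq_big => [a|a _]; first by rewrite addnC.
  by rewrite linear_sumlz.
rewrite (eq_bigr (fun c : 'I_N.+1 => \sum_(a : 'I_N.+1) \sum_(b : 'I_N.+1 |
   (c + (a + b))%N == i) m (m (der0 D a x) (der0 D b y)) (der0 D c z)));
  last by move=> c _; rewrite pair_big_dep.
rewrite exchange_big /=; apply: eq_bigr => a _ /=.
rewrite (exchange_big_dep xpredT) //= pair_big_dep /=.
by apply: eq_bigl => p; rewrite addnC -addnA.
Qed.

(** The convolutions in which a map is applied to a product of two arguments cancel. What remains is
    [der0 D i] of the two bracketings and the two triple sums, which pair up into associators. *)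
Lemma leib_associator (i : 'I_N.+1) x y z :
  \sum_(p : 'I_N.+1 * 'I_N.+1 | (p.1 + p.2)%N == i)
     m (der0 D p.1 x) (leib p.2 y z)
  - leib i (m x y) z + leib i x (m y z)
  - \sum_(p : 'I_N.+1 * 'I_N.+1 | (p.1 + p.2)%N == i)
      m (leib p.1 x y) (der0 D p.2 z)
  = \sum_(a : 'I_N.+1) \sum_(p : 'I_N.+1 * 'I_N.+1 | (a + (p.1 + p.2))%N == i)
       associator (der0 D a x) (der0 D p.1 y) (der0 D p.2 z)
    - der0 D i (associator x y z).
Proof.
rewrite sum_leib_r sum_leib_l /leib /associator.
under [in RHS]eq_bigr do rewrite sumrB; rewrite sumrB.
have -> : der0 D i (m (m x y) z - m x (m y z)) =
    der0 D i (m (m x y) z) - der0 D i (m x (m y z)).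
  exact: (zmod_morphism_linear (linear_der0 i)).
rewrite !opprB [LHS](ACl ((4*2)*(3*1))) /= !subrKA.
by rewrite [LHS]addrACA [RHS]addrACA; congr (_ + _); apply: addrC.
Qed.

End Defects.

(** * Truncated series *)

Section TruncatedExtension.

Variables (K : fieldType) (A : lmodType K) (n : nat).
Implicit Types (M : 'I_n.+1 -> A -> A -> A) (f : 'I_n.+1 -> A -> A).
Implicit Types (x y z u : tseries A n).

(** The index [s] is determined by [t], and is in range because [a + w t] equals [i]. The weight is
    arbitrary in order to cover both the pairs of [tmap] and the triples of [tmul]. *)
Lemma sum_weight_conv (V : zmodType) (T : finType) (w : T -> nat)
    (i : 'I_n.+1) (a : nat) (G : T -> V) :
  \sum_(s : 'I_n.+1 | (a + s)%N == i) \sum_(t : T | w t == s) G t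
  = \sum_(t : T | (a + w t)%N == i) G t.
Proof.
rewrite (exchange_big_dep (fun t => (a + w t)%N == i)) /=; last first.
  by move=> s t /eqP Hs /eqP ->; rewrite Hs.
apply: eq_bigr => t /eqP Ht.
have Hs : (w t < n.+1)%N.
  by apply: leq_ltn_trans (ltn_ord i); rewrite -Ht leq_addl.
rewrite (big_pred1 (Ordinal Hs)) // => s; rewrite /= -val_eqE /= [RHS]eq_sym.
have [<-|] := w t =P s; last by rewrite andbF.
by rewrite Ht eqxx.
Qed.

Lemma tcoefD x y i : (x + y) i = x i + y i. Proof. by rewrite ffunE. Qed.

Lemma tcoef0 i : (0 : tseries A n) i = 0. Proof. by rewrite ffunE. Qed.

Lemma tcoefB x y i : (x - y) i = x i - y i. Proof. by rewrite !ffunE. Qed.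

Lemma tcoef_BDB x y z u i : (x - y + z - u) i = x i - y i + z i - u i.
Proof. by rewrite !ffunE. Qed.

Lemma tcoef_sum I r (P : pred I) (F : I -> tseries A n) i :
  (\sum_(j <- r | P j) F j) i = \sum_(j <- r | P j) F j i.
Proof. exact: sum_ffunE. Qed.

Lemma tscaleE (c : tring K n) x m :
  (c *: x) m = \sum_(ij : 'I_n.+1 * 'I_n.+1 | (ij.1 + ij.2)%N == m)
     (c : {poly K})`_ij.1 *: x ij.2.
Proof. by rewrite ffunE. Qed.

Lemma tmulE M x y (m : 'I_n.+1) :
  tmul M x y m =
  \sum_(i : 'I_n.+1) \sum_(j : 'I_n.+1) \sum_(l : 'I_n.+1 | (i + j + l)%N == m)
     M i (x j) (y l).
Proof.
rewrite ffunE [RHS]pair_bigA /= pair_big_dep /=.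
by apply: eq_bigl => -[[i j] l].
Qed.

Lemma tmapE f x (m : 'I_n.+1) :
  tmap f x m =
  \sum_(i : 'I_n.+1) \sum_(j : 'I_n.+1 | (i + j)%N == m) f i (x j).
Proof. by rewrite ffunE pair_big_dep. Qed.

(** Reduces statements on the left argument of [tmul] to the right one, or conversely. *)
Lemma tmul_flip M x y : tmul (fun i a b => M i b a) y x = tmul M x y.
Proof.
apply/ffunP => m; rewrite !tmulE; apply: eq_bigr => i _.
rewrite (exchange_big_dep xpredT) //=; apply: eq_bigr => j _.
by apply: eq_bigl => l; rewrite addnAC.
Qed.

Lemma tscale_sum (T : finType) (w : T -> nat) (c : tring K n) x
    (G : T -> A) (m : 'I_n.+1) :
  (forall s : 'I_n.+1, x s = \sum_(t | w t == s) G t) ->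
  (c *: x) m =
  \sum_(a : 'I_n.+1) \sum_(t | (a + w t)%N == m) (c : {poly K})`_a *: G t.
Proof.
move=> xE; rewrite tscaleE.
rewrite (sum_pairE (fun a s : 'I_n.+1 => (a + s)%N == m)
   (fun a s => (c : {poly K})`_a *: x s)).
apply: eq_bigr => a _; rewrite -[RHS]sum_weight_conv; apply: eq_bigr => s _.
by rewrite xE scaler_sumr.
Qed.

(** Once the linearity of each [f i] over [K] pulls out the coefficients of the scalar, both sides
    are the same sum over triples: an index of [f], one of the scalar and one of the series. *)
Lemma tmap_linear f : (forall i, linear (f i)) -> linear (tmap f).
Proof.
move=> f_lin c x y; apply/ffunP => m; rewrite [RHS]ffunE.
rewrite (@tscale_sum _ (fun ij : 'I_n.+1 * 'I_n.+1 => (ij.1 + ij.2)%N)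
  c _ (fun ij => f ij.1 (x ij.2))); last by move=> s; rewrite ffunE.
rewrite !tmapE.
transitivity (\sum_(i : 'I_n.+1) ((\sum_(j : 'I_n.+1 | (i + j)%N == m)
    f i ((c *: x) j)) + \sum_(j : 'I_n.+1 | (i + j)%N == m) f i (y j))).
  apply: eq_bigr => i _; rewrite -big_split; apply: eq_bigr => j _.
  by rewrite ffunE -[X in f i (X + _)]scale1r f_lin scale1r.
rewrite big_split /=; congr (_ + _).
pose fL i : {linear A -> A} :=
  HB.pack (f i) (GRing.isLinear.Build K A A *:%R (f i) (f_lin i)).
transitivity (\sum_(i : 'I_n.+1) \sum_(p : 'I_n.+1 * 'I_n.+1 |
    (i + (p.1 + p.2))%N == m) (c : {poly K})`_p.1 *: f i (x p.2)).
  apply: eq_bigr => i _; rewrite -sum_conv; apply: eq_bigr => j _.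
  rewrite tscaleE -[f i]/(fL i : _ -> _) linear_sum.
  by apply: eq_bigr => p _; rewrite linearZ.
transitivity (\sum_(i : 'I_n.+1) \sum_(a : 'I_n.+1) \sum_(j : 'I_n.+1 |
    (i + (a + j))%N == m) (c : {poly K})`_a *: f i (x j)).
  by apply: eq_bigr => i _; rewrite pair_big_dep.
rewrite exchange_big /=; apply: eq_bigr => a _; rewrite pair_big_dep /=.
by apply: eq_bigl => p; rewrite addnCA.
Qed.

Lemma tmul_linear_r M x :
  (forall i a, linear (M i a)) -> linear (tmul M x).
Proof.
move=> M_lin c y z; apply/ffunP => m; rewrite [RHS]ffunE.
rewrite (@tscale_sum _
  (fun t : 'I_n.+1 * 'I_n.+1 * 'I_n.+1 => (t.1.1 + t.1.2 + t.2)%N)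
  c _ (fun t => M t.1.1 (x t.1.2) (y t.2))); last by move=> s; rewrite ffunE.
rewrite !tmulE.
transitivity (\sum_(i : 'I_n.+1) \sum_(j : 'I_n.+1)
   ((\sum_(l : 'I_n.+1 | (i + j + l)%N == m) M i (x j) ((c *: y) l)) +
    \sum_(l : 'I_n.+1 | (i + j + l)%N == m) M i (x j) (z l))).
  apply: eq_bigr => i _; apply: eq_bigr => j _.
  rewrite -big_split; apply: eq_bigr => l _.
  by rewrite ffunE -[X in M i (x j) (X + _)]scale1r M_lin scale1r.
under eq_bigr do rewrite big_split /=.
rewrite big_split /=; congr (_ + _).
pose ML i a : {linear A -> A} :=
  HB.pack (M i a) (GRing.isLinear.Build K A A *:%R (M i a) (M_lin i a)).
transitivity (\sum_(i : 'I_n.+1) \sum_(j : 'I_n.+1)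
    \sum_(p : 'I_n.+1 * 'I_n.+1 | (i + j + (p.1 + p.2))%N == m)
      (c : {poly K})`_p.1 *: M i (x j) (y p.2)).
  apply: eq_bigr => i _; apply: eq_bigr => j _.
  rewrite -sum_conv; apply: eq_bigr => l _.
  rewrite tscaleE -[M i (x j)]/(ML i (x j) : _ -> _) linear_sum.
  by apply: eq_bigr => p _; rewrite linearZ.
transitivity (\sum_(i : 'I_n.+1) \sum_(j : 'I_n.+1) \sum_(a : 'I_n.+1)
   \sum_(l : 'I_n.+1 | (i + j + (a + l))%N == m)
     (c : {poly K})`_a *: M i (x j) (y l)).
  by apply: eq_bigr => i _; apply: eq_bigr => j _; rewrite pair_big_dep.
rewrite pair_bigA exchange_big /=; apply: eq_bigr => a _.
rewrite pair_big_dep /=.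
by apply: eq_bigl => p; rewrite addnCA.
Qed.

Lemma tmul_bilinear M : (forall i, is_bilinear (M i)) -> is_bilinear (tmul M).
Proof.
move=> M_bil; split=> [y|x]; last by apply: tmul_linear_r => i; case: (M_bil i).
move=> c x x'; rewrite -!(tmul_flip M _ y).
by apply: tmul_linear_r => i a; case: (M_bil i).
Qed.

End TruncatedExtension.

(** * The coefficient of highest order *)

Section TopCoefficient.

Variables (K : fieldType) (A : lmodType K) (n : nat).
Implicit Types (M : 'I_n.+2 -> A -> A -> A) (f : 'I_n.+2 -> A -> A).
Implicit Types (x y : tseries A n.+1).

Definition tconst (a : A) : tseries A n.+1 :=
  [ffun i : 'I_n.+2 => if i == ord0 then a else 0].

Definition ttop (a : A) : tseries A n.+1 :=
  [ffun i : 'I_n.+2 => if i == ord_max then a else 0].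

(** The projection of A[[t]]/(t^(n+2)) onto A[[t]]/(t^(n+1)), with kernel t^(n+1) A, the range of
    [ttop]. It is registered only as additive, its two sides being modules over different rings. *)
Definition trunc x : tseries A n := [ffun i : 'I_n.+1 => x (lift ord_max i)].

Lemma tconst0 a : tconst a ord0 = a. Proof. by rewrite ffunE. Qed.

Lemma ttop0 a : ttop a ord0 = 0. Proof. by rewrite ffunE. Qed.

Lemma ttop_max a : ttop a ord_max = a. Proof. by rewrite ffunE eqxx. Qed.

Lemma trunc_ttop a : trunc (ttop a) = 0.
Proof.
by apply/ffunP => i; rewrite !ffunE eq_sym (negbTE (neq_lift _ _)).
Qed.

Lemma trunc_zmod_morphism : zmod_morphism trunc.
Proof. by move=> x y; apply/ffunP => i; rewrite !ffunE. Qed.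

HB.instance Definition _ :=
  GRing.isZmodMorphism.Build (tseries A n.+1) (tseries A n) trunc
    trunc_zmod_morphism.

Lemma tseries_split x : trunc x = 0 -> x ord_max = 0 -> x = 0.
Proof.
move=> /ffunP x0 xm; apply/ffunP => i; rewrite ffunE.
by case: (unliftP ord_max i) => [j ->|->//]; have := x0 j; rewrite !ffunE.
Qed.

Lemma trunc_eq0 x i : trunc x = 0 -> i != ord_max -> x i = 0.
Proof.
move=> /ffunP x0; case: (unliftP ord_max i) => [j ->|->]; last by rewrite eqxx.
by have := x0 j; rewrite !ffunE.
Qed.

Lemma bump_ord (j : 'I_n.+1) : bump n.+1 j = j.
Proof. exact: lift_max. Qed.

Lemma sum_lift_max (V : zmodType) (P : pred 'I_n.+2) (G : 'I_n.+2 -> V) :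
  (P ord_max -> G ord_max = 0) ->
  \sum_(i : 'I_n.+2 | P i) G i =
  \sum_(i : 'I_n.+1 | P (lift ord_max i)) G (lift ord_max i).
Proof.
move=> Gm; rewrite big_mkcond big_ord_recr /= [RHS]big_mkcond.
have -> : (if P ord_max then G ord_max else 0) = 0 by case: ifP => // /Gm.
rewrite addr0; apply: eq_bigr => i _.
suff -> : widen_ord (leqnSn n.+1) i = lift ord_max i by [].
by apply: val_inj; rewrite /= /bump leqNgt ltn_ord.
Qed.

Lemma extend_lift (T : Type) (u : 'I_n.+1 -> T) v j :
  extend u v (lift ord_max j) = u j.
Proof. by rewrite /extend liftK. Qed.

Lemma extend_max (T : Type) (u : 'I_n.+1 -> T) v : extend u v ord_max = v.
Proof. by rewrite /extend unlift_none. Qed.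

Lemma extend0 (T : Type) (u : 'I_n.+1 -> T) v : extend u v ord0 = u ord0.
Proof.
by rewrite -(extend_lift u v ord0); congr extend; apply: val_inj.
Qed.

Lemma extend_ind (T : Type) (P : T -> Prop) (u : 'I_n.+1 -> T) v :
  (forall i, P (u i)) -> P v -> forall i, P (extend u v i).
Proof. by move=> Pu Pv i; rewrite /extend; case: unlift. Qed.

(** In degrees up to n an index n+1 overshoots, so neither [v] nor the top coefficient of [x]
    enters. *)
Lemma trunc_tmap (f : 'I_n.+1 -> A -> A) v x :
  trunc (tmap (extend f v) x) = tmap f (trunc x).
Proof.
apply/ffunP => m; rewrite ffunE !tmapE.
have neqm (i : nat) : (n.+1 <= i)%N -> (i == lift ord_max m)%N = false.
  rewrite lift_max => le_ni; apply/negbTE; rewrite neq_ltn orbC.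
  by rewrite (leq_trans (ltn_ord m)).
rewrite (sum_lift_max (P := xpredT)) /=; last first.
  by rewrite big_pred0 // => j; rewrite neqm ?leq_addr.
apply: eq_bigr => i _; rewrite sum_lift_max ?neqm ?leq_addl //.
by apply: eq_big => [j|j _];
  rewrite ?bump_ord ?lift_max ?extend_lift ?ffunE.
Qed.

Lemma trunc_tmul (M : 'I_n.+1 -> A -> A -> A) v x y :
  trunc (tmul (extend M v) x y) = tmul M (trunc x) (trunc y).
Proof.
apply/ffunP => m; rewrite ffunE !tmulE.
have neqm (i : nat) : (n.+1 <= i)%N -> (i == lift ord_max m)%N = false.
  rewrite lift_max => le_ni; apply/negbTE; rewrite neq_ltn orbC.
  by rewrite (leq_trans (ltn_ord m)).
rewrite (sum_lift_max (P := xpredT)) /=; last first.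
  by rewrite big1 // => j _; rewrite big_pred0 // => l;
    rewrite neqm // -addnA leq_addr.
apply: eq_bigr => i _; rewrite (sum_lift_max (P := xpredT)) /=; last first.
  by rewrite big_pred0 // => l; rewrite neqm // addnAC leq_addl.
apply: eq_bigr => j _; rewrite sum_lift_max ?neqm ?leq_addl //.
by apply: eq_big => [l|l _];
  rewrite ?bump_ord ?lift_max ?extend_lift ?ffunE.
Qed.

Lemma tmul0E M x y : tmul M x y ord0 = M ord0 (x ord0) (y ord0).
Proof.
rewrite ffunE (big_pred1 (ord0, ord0, ord0)) // => -[[i j] l] /=.
by rewrite !addn_eq0 !xpair_eqE -!val_eqE.
Qed.

Lemma tmap0E f x : tmap f x ord0 = f ord0 (x ord0).
Proof.
rewrite ffunE (big_pred1 (ord0, ord0)) // => -[i j] /=.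
by rewrite !addn_eq0 !xpair_eqE -!val_eqE.
Qed.

(** For [x] in t^(n+1) A, a positive power of t coming from [f] leads beyond the truncation. *)
Lemma tmap_max f x : (forall i, f i 0 = 0) -> trunc x = 0 ->
  tmap f x ord_max = f ord0 (x ord_max).
Proof.
move=> f0 x0; rewrite ffunE (bigD1 (ord0, ord_max)) //= big1 ?addr0 //.
move=> [i j] /= /andP[/eqP ij neq].
have [jm|jm] := eqVneq j ord_max; last by rewrite (trunc_eq0 x0 jm) f0.
case/negP: neq; rewrite jm xpair_eqE eqxx andbT -val_eqE /=.
by move: ij; rewrite jm -[RHS]add0n => /addIn ->.
Qed.

(** The factor [x] uses up the whole degree n+1, which leaves only the constant terms of [M] and
    [y]. *)
Lemma tmul_max_l M x y : (forall i a, M i 0 a = 0) -> trunc x = 0 ->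
  tmul M x y ord_max = M ord0 (x ord_max) (y ord0).
Proof.
move=> M0 x0; rewrite ffunE (bigD1 (ord0, ord_max, ord0)) //= ?addn0 //.
rewrite big1 ?addr0 // => -[[i j] l] /= /andP[/eqP ijl neq].
have [jm|jm] := eqVneq j ord_max; last by rewrite (trunc_eq0 x0 jm) M0.
case/negP: neq; rewrite jm !xpair_eqE eqxx andbT -!val_eqE /= -addn_eq0.
by move: ijl; rewrite jm addnAC -[RHS]add0n => /addIn ->.
Qed.

Lemma tmul_max_r M x y : (forall i a, M i a 0 = 0) -> trunc y = 0 ->
  tmul M x y ord_max = M ord0 (x ord0) (y ord_max).
Proof. by move=> M0 y0; rewrite -tmul_flip tmul_max_l. Qed.

(** A coefficient of t^(n+1) can only meet the constant term of [x]; lower degrees agree by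
    [trunc_tmap]. *)
Lemma tmap_extend (f : 'I_n.+1 -> A -> A) v x :
  tmap (extend f v) x = tmap (extend f (fun=> 0)) x + ttop (v (x ord0)).
Proof.
apply/eqP; rewrite -subr_eq0; apply/eqP/tseries_split.
  by rewrite opprD !raddfD !raddfN /= !trunc_tmap trunc_ttop subr0 subrr.
rewrite opprD !ffunE eqxx addrA -sumrB.
rewrite (bigD1 (ord_max, ord0)) ?addn0 //= !extend_max subr0.
rewrite big1 ?addr0 ?subrr // => -[i j] /= /andP[/eqP ij neq].
case: (unliftP ord_max i) => [i' ->|im]; first by rewrite !extend_lift subrr.
case/negP: neq; rewrite im xpair_eqE eqxx /= -val_eqE /=.
by move: ij; rewrite im -[RHS]addn0 => /addnI ->.
Qed.

Lemma tmul_extend (M : 'I_n.+1 -> A -> A -> A) v x y :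
  tmul (extend M v) x y =
  tmul (extend M (fun _ _ => 0)) x y + ttop (v (x ord0) (y ord0)).
Proof.
apply/eqP; rewrite -subr_eq0; apply/eqP/tseries_split.
  by rewrite opprD !raddfD !raddfN /= !trunc_tmul trunc_ttop subr0 subrr.
rewrite opprD !ffunE eqxx addrA -sumrB.
rewrite (bigD1 (ord_max, ord0, ord0)) ?addn0 //= !extend_max subr0.
rewrite big1 ?addr0 ?subrr // => -[[i j] l] /= /andP[/eqP ijl neq].
case: (unliftP ord_max i) => [i' ->|im]; first by rewrite !extend_lift subrr.
case/negP: neq; rewrite im !xpair_eqE eqxx /= -!val_eqE /= -addn_eq0.
by move: ijl; rewrite im -addnA -[RHS]addn0 => /addnI ->.
Qed.

(** * Multiplication of series by scalars and by t *)

Lemma coef_in_tring (p : {poly K}) i : (size p <= n.+2)%N ->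
  ((in_qpoly 'X^(n.+2) p : tring K n.+1) : {poly K})`_i = p`_i.
Proof.
by move=> sp; rewrite in_qpoly_small // mk_monic_Xn size_polyXn ltnS.
Qed.

Definition tscalar (k : K) : tring K n.+1 := in_qpoly 'X^(n.+2) k%:P.
Definition tvar : tring K n.+1 := in_qpoly 'X^(n.+2) 'X.

Lemma tscalarE k x i : (tscalar k *: x) i = k *: x i.
Proof.
have E j : (tscalar k : {poly K})`_j = (k%:P)`_j.
  by rewrite coef_in_tring // (leq_trans (size_polyC_leq1 _)).
rewrite tscaleE (bigD1 (ord0, i)) //= E coefC eqxx big1 ?addr0 //.
move=> [a b] /= /andP[/eqP ab neq]; rewrite E coefC.
case: eqP => [a0|]; last by rewrite scale0r.
case/negP: neq; rewrite xpair_eqE -!val_eqE /= a0 eqxx /=.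
by rewrite -ab a0.
Qed.

Lemma coef_tvar i : (tvar : {poly K})`_i = (i == 1%N)%:R.
Proof. by rewrite coef_in_tring ?coefX // size_polyX. Qed.

Lemma tvar_scale0 x : (tvar *: x) ord0 = 0.
Proof.
rewrite tscaleE big1 // => -[a b] /= /eqP/eqP.
by rewrite addn_eq0 coef_tvar => /andP[/eqP -> _]; rewrite scale0r.
Qed.

(** Multiplication by t is a shift: [lift ord0 j] has value j+1, while [lift ord_max j] has value
    j. *)
Lemma tvar_scale_lift x (j : 'I_n.+1) :
  (tvar *: x) (lift ord0 j) = x (lift ord_max j).
Proof.
rewrite tscaleE (bigD1 (lift ord0 ord0, lift ord_max j)) /=; last first.
  by rewrite bump_ord.
rewrite coef_tvar /= scale1r big1 ?addr0 //.
move=> [a b] /= /andP[/eqP ab neq]; rewrite coef_tvar.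
case: eqP => [a1|]; last by rewrite scale0r.
case/negP: neq; rewrite xpair_eqE -!val_eqE /= bump_ord a1 /bump /= ?eqxx.
by move: ab; rewrite a1 /bump /= => /addnI ->.
Qed.

Lemma tvar_divides x : x ord0 = 0 -> exists y, x = tvar *: y.
Proof.
(* The downward shift of [x]. Its top coefficient is free, as multiplication by t kills it; 0 is
   chosen. *)
pose y : tseries A n.+1 := [ffun i : 'I_n.+2 =>
  extend (fun j => x (lift ord0 j)) 0 i].
move=> x0; exists y.
apply/ffunP => i; case: (unliftP ord0 i) => [j ->|->].
  by rewrite tvar_scale_lift ffunE extend_lift.
by rewrite tvar_scale0.
Qed.

(* phi (t x) = t phi x lies in t^(n+2) A, which is 0. *)
Lemma top_linear_const (phi : tseries A n.+1 -> tseries A n.+1) x :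
  linear phi -> (forall z, trunc (phi z) = 0) ->
  phi x ord_max = phi (tconst (x ord0)) ord_max.
Proof.
move=> phi_lin phi_trunc.
have [|y xE] := @tvar_divides (x - tconst (x ord0)).
  by rewrite !ffunE eqxx subrr.
rewrite -[x in LHS](subrK (tconst (x ord0))) xE phi_lin ffunE.
rewrite -[RHS]add0r; congr (_ + _).
have -> : ord_max = lift ord0 ord_max :> 'I_n.+2 by apply: val_inj.
by rewrite tvar_scale_lift (trunc_eq0 (phi_trunc y)) // eq_sym neq_lift.
Qed.

(** [K] acts on series through [tscalar], so linearity over the truncated ring gives linearity over
    [K]. *)
Lemma top_const_linear (phi : tseries A n.+1 -> tseries A n.+1) :
  linear phi -> linear (fun a => phi (tconst a) ord_max).
Proof.
move=> phi_lin k a b.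
have -> : tconst (k *: a + b) = tscalar k *: tconst a + tconst b.
  apply/ffunP => i; rewrite [RHS]ffunE tscalarE !ffunE.
  by case: ifP => // _; rewrite scaler0 addr0.
by rewrite phi_lin ffunE tscalarE.
Qed.

End TopCoefficient.

(** * The complex in low degrees *)

Section LowDegree.

Variables (K : fieldType) (A : lmodType K) (N : nat).
Variables (mu : A -> A -> A) (d : 'I_N -> A -> A).

(* The sequence s is truncated, or padded with 0, to length n. *)
Definition args n (s : seq A) : {ffun 'I_n -> A} := [ffun j : 'I_n => s`_j].

Lemma args_behead_args n (s : seq A) :
  args_behead (args n.+1 s) = args n (behead s).
Proof. by apply/ffunP => j; rewrite !ffunE nth_behead. Qed.

Lemma args_belast_args n (s : seq A) : args_belast (args n.+1 s) = args n s.
Proof. by apply/ffunP => j; rewrite !ffunE lift_max. Qed.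

Lemma argsP n (a : {ffun 'I_n -> A}) : exists2 s, size s = n & a = args n s.
Proof.
exists [seq a j | j <- enum 'I_n]; first by rewrite size_map size_enum_ord.
apply/ffunP => j; rewrite ffunE (nth_map j) ?size_enum_ord //.
by rewrite nth_ord_enum.
Qed.

Lemma delta_Hoch2E (f : nfun A 2) x y z :
  delta_Hoch mu f (args 3 [:: x; y; z]) =
  mu x (f (args 2 [:: y; z])) - f (args 2 [:: mu x y; z])
  + f (args 2 [:: x; mu y z]) - mu (f (args 2 [:: x; y])) z.
Proof.
rewrite /delta_Hoch args_behead_args args_belast_args !ffunE /=.
rewrite !big_ord_recl big_ord0 addr0 /= !exprS expr0 !mulN1r !opprK !scaleN1r.
rewrite !scale1r !addrA.
(* [args_belast_args] leaves the list one entry too long; [args] ignores the excess. *)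
have -> : args 2 [:: x; y; z] = args 2 [:: x; y].
  by apply/ffunP => -[[|[|//]] Hl]; rewrite !ffunE.
have -> : args_mul mu ord0 (args 3 [:: x; y; z]) = args 2 [:: mu x y; z].
  by apply/ffunP => -[[|[|//]] Hl]; rewrite !ffunE.
by have -> : args_mul mu (lift ord0 ord0) (args 3 [:: x; y; z]) =
    args 2 [:: x; mu y z] by apply/ffunP => -[[|[|//]] Hl]; rewrite !ffunE.
Qed.

Lemma delta_Hoch3E (f : nfun A 3) x y z t :
  delta_Hoch mu f (args 4 [:: x; y; z; t]) =
  mu x (f (args 3 [:: y; z; t])) - f (args 3 [:: mu x y; z; t])
  + f (args 3 [:: x; mu y z; t]) - f (args 3 [:: x; y; mu z t])
  + mu (f (args 3 [:: x; y; z])) t.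
Proof.
rewrite /delta_Hoch args_behead_args args_belast_args !ffunE /=.
rewrite !big_ord_recl big_ord0 addr0 /= !exprS expr0 !mulN1r !opprK !scaleN1r.
rewrite !scale1r !addrA.
have -> : args 3 [:: x; y; z; t] = args 3 [:: x; y; z].
  by apply/ffunP => -[[|[|[|//]]] Hl]; rewrite !ffunE.
have -> : args_mul mu ord0 (args 4 [:: x; y; z; t]) = args 3 [:: mu x y; z; t].
  by apply/ffunP => -[[|[|[|//]]] Hl]; rewrite !ffunE.
have -> : args_mul mu (lift ord0 ord0) (args 4 [:: x; y; z; t]) =
    args 3 [:: x; mu y z; t].
  by apply/ffunP => -[[|[|[|//]]] Hl]; rewrite !ffunE.
by have -> : args_mul mu (lift ord0 (lift ord0 ord0)) (args 4 [:: x; y; z; t]) =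
    args 3 [:: x; y; mu z t]
  by apply/ffunP => -[[|[|[|//]]] Hl]; rewrite !ffunE.
Qed.

(** Turns a sum of [delta'_Hoch], where one index is at least 1, into a full convolution as in
    [leib_associator]. *)
Lemma sum_lift_r (V : zmodType) (q : nat) (G : 'I_N.+1 -> 'I_N.+1 -> V) :
  (forall i, G i ord0 = 0) ->
  \sum_(p : 'I_N.+1 * 'I_N | (p.1 + p.2.+1)%N == q) G p.1 (lift ord0 p.2) =
  \sum_(p : 'I_N.+1 * 'I_N.+1 | (p.1 + p.2)%N == q) G p.1 p.2.
Proof.
move=> G0; rewrite -[RHS](pair_big_dep xpredT
  (fun i j : 'I_N.+1 => (i + j)%N == q)) /=.
rewrite -(pair_big_dep xpredT (fun (i : 'I_N.+1) (j : 'I_N) =>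
  (i + j.+1)%N == q) (fun i j => G i (lift ord0 j))) /=.
apply: eq_bigr => i _; rewrite [RHS]big_mkcond big_ord_recl /= G0 if_same add0r.
by rewrite big_mkcond.
Qed.

Lemma sum_lift_l (V : zmodType) (q : nat) (G : 'I_N.+1 -> 'I_N.+1 -> V) :
  (forall j, G ord0 j = 0) ->
  \sum_(p : 'I_N * 'I_N.+1 | (p.1.+1 + p.2)%N == q) G (lift ord0 p.1) p.2 =
  \sum_(p : 'I_N.+1 * 'I_N.+1 | (p.1 + p.2)%N == q) G p.1 p.2.
Proof.
move=> G0; rewrite -[RHS](pair_big_dep xpredT
  (fun i j : 'I_N.+1 => (i + j)%N == q)) /=.
rewrite -(pair_big_dep xpredT (fun (i : 'I_N) (j : 'I_N.+1) =>
  (i.+1 + j)%N == q) (fun i j => G (lift ord0 i) j)) /=.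
rewrite [RHS]big_ord_recl /= [X in _ = X + _]big1 ?add0r //.
Qed.

(** Multi-indices are finite functions in [delta] but pairs in the Leibniz defects. *)
Lemma sum_ffun2 (V : zmodType) (T : finType) (P : {ffun 'I_2 -> T} -> bool)
    (G : {ffun 'I_2 -> T} -> V) :
  \sum_(i | P i) G i =
  \sum_(p : T * T | P [ffun l : 'I_2 => if l == ord0 then p.1 else p.2])
     G [ffun l : 'I_2 => if l == ord0 then p.1 else p.2].
Proof.
pose h (p : T * T) : {ffun 'I_2 -> T} :=
  [ffun l : 'I_2 => if l == ord0 then p.1 else p.2].
rewrite (reindex h) //.
exists (fun i : {ffun 'I_2 -> T} => (i ord0, i ord_max)) => [p _|i _].
  by rewrite !ffunE; case: p.
by apply/ffunP => -[[|[|//]] Hl]; rewrite ffunE; congr (i _); apply: val_inj.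
Qed.

(** The nesting, an index followed by a pair, is that of the triple sum in [leib_associator]. *)
Lemma sum_ffun3 (V : zmodType) (T : finType) (P : {ffun 'I_3 -> T} -> bool)
    (G : {ffun 'I_3 -> T} -> V) (h := fun (a : T) (p : T * T) =>
      [ffun l : 'I_3 => nth a [:: a; p.1; p.2] l] : {ffun 'I_3 -> T}) :
  \sum_(i | P i) G i = \sum_a \sum_(p : T * T | P (h a p)) G (h a p).
Proof.
rewrite pair_big_dep (reindex (fun ap : T * (T * T) => h ap.1 ap.2)) //=.
exists (fun i : {ffun 'I_3 -> T} =>
  (i ord0, (i (lift ord0 ord0), i ord_max))) => [p _|i _].
  by rewrite !ffunE; case: p => a [].
by apply/ffunP => -[[|[|[|//]]] Hl]; rewrite ffunE /=; congr (i _);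
  apply: val_inj.
Qed.

Lemma delta2E (k : 'I_N) (f : nfun A 2) x y :
  delta d k f (args 2 [:: x; y]) =
  \sum_(p : 'I_N.+1 * 'I_N.+1 | (p.1 + p.2)%N == k.+1)
     f (args 2 [:: der0 d p.1 x; der0 d p.2 y])
  - d k (f (args 2 [:: x; y])).
Proof.
rewrite /delta sum_ffun2; congr (_ - _); apply: eq_big => [p|p _].
  by rewrite !big_ord_recl big_ord0 !ffunE /= addn0.
by congr f; apply/ffunP => -[[|[|//]] Hl]; rewrite !ffunE.
Qed.

Lemma delta3E (k : 'I_N) (f : nfun A 3) x y z :
  delta d k f (args 3 [:: x; y; z]) =
  \sum_(a : 'I_N.+1)
    \sum_(p : 'I_N.+1 * 'I_N.+1 | (a + (p.1 + p.2))%N == k.+1)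
       f (args 3 [:: der0 d a x; der0 d p.1 y; der0 d p.2 z])
  - d k (f (args 3 [:: x; y; z])).
Proof.
rewrite /delta sum_ffun3; congr (_ - _); apply: eq_bigr => a _.
apply: eq_big => [p|p _].
  by rewrite !big_ord_recl big_ord0 !ffunE /= addn0.
by congr f; apply/ffunP => -[[|[|[|//]]] Hl]; rewrite !ffunE.
Qed.

Hypothesis mu_bilinear : is_bilinear mu.
HB.instance Definition _ :=
  bilinear_isBilinear.Build K A A A *:%R *:%R mu mu_bilinear.

(* Prepending g 0 = 0 to the family f makes both sums of delta' range over all
   pairs (i, j) with i + j = k. *)
Lemma delta'_Hoch1E (f : 'I_N -> nfun A 1) (g : 'I_N.+1 -> A -> A) k x y :
  (forall a, g ord0 a = 0) ->
  (forall j a, g (lift ord0 j) a = f j (args 1 [:: a])) ->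
  delta'_Hoch mu d f k (args 2 [:: x; y]) =
  \sum_(p : 'I_N.+1 * 'I_N.+1 | (p.1 + p.2)%N == k.+1)
     mu (der0 d p.1 x) (g p.2 y)
  - f k (args 1 [:: mu x y])
  + \sum_(p : 'I_N.+1 * 'I_N.+1 | (p.1 + p.2)%N == k.+1)
     mu (g p.1 x) (der0 d p.2 y).
Proof.
move=> g0 gS; rewrite /delta'_Hoch args_behead_args args_belast_args !ffunE /=.
rewrite big_ord1 /= !exprS expr0 !mulN1r opprK scaleN1r scale1r.
have -> : args 1 [:: x; y] = args 1 [:: x].
  by apply/ffunP => j; rewrite !ffunE (ord1 j).
have -> : args_mul mu ord0 (args 2 [:: x; y]) = args 1 [:: mu x y].
  by apply/ffunP => j; rewrite !ffunE (ord1 j).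
congr (_ - _ + _).
  rewrite -(@sum_lift_r _ k.+1 (fun i j => mu (der0 d i x) (g j y))).
    by apply: eq_bigr => p _; rewrite gS.
  by move=> i; rewrite g0 linear0r.
rewrite -(@sum_lift_l _ k.+1 (fun i j => mu (g i x) (der0 d j y))).
  by apply: eq_bigr => p _; rewrite gS.
by move=> i; rewrite g0 linear0l.
Qed.

(** Padding by [g ord0] as in arity one gives the right side the shape of the left side of
    [leib_associator]. *)
Lemma delta'_Hoch2E (f : 'I_N -> nfun A 2) (g : 'I_N.+1 -> A -> A -> A)
    k x y z :
  (forall a b, g ord0 a b = 0) ->
  (forall j a b, g (lift ord0 j) a b = f j (args 2 [:: a; b])) ->
  delta'_Hoch mu d f k (args 3 [:: x; y; z]) =
  \sum_(p : 'I_N.+1 * 'I_N.+1 | (p.1 + p.2)%N == k.+1)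
     mu (der0 d p.1 x) (g p.2 y z)
  - f k (args 2 [:: mu x y; z]) + f k (args 2 [:: x; mu y z])
  - \sum_(p : 'I_N.+1 * 'I_N.+1 | (p.1 + p.2)%N == k.+1)
     mu (g p.1 x y) (der0 d p.2 z).
Proof.
move=> g0 gS; rewrite /delta'_Hoch args_behead_args args_belast_args !ffunE /=.
rewrite !big_ord_recl big_ord0 addr0 /= !exprS expr0 !mulN1r !opprK !scaleN1r.
rewrite !scale1r !addrA.
have -> : args 2 [:: x; y; z] = args 2 [:: x; y].
  by apply/ffunP => -[[|[|//]] Hl]; rewrite !ffunE.
have -> : args_mul mu ord0 (args 3 [:: x; y; z]) = args 2 [:: mu x y; z].
  by apply/ffunP => -[[|[|//]] Hl]; rewrite !ffunE.
have -> : args_mul mu (lift ord0 ord0) (args 3 [:: x; y; z]) =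
    args 2 [:: x; mu y z] by apply/ffunP => -[[|[|//]] Hl]; rewrite !ffunE.
congr (_ - _ + _ - _).
  rewrite -(@sum_lift_r _ k.+1 (fun i j => mu (der0 d i x) (g j y z))).
    by apply: eq_bigr => p _; rewrite gS.
  by move=> i; rewrite g0 linear0r.
rewrite -(@sum_lift_l _ k.+1 (fun i j => mu (g i x y) (der0 d j z))).
  by apply: eq_bigr => p _; rewrite gS.
by move=> i; rewrite g0 linear0l.
Qed.

Lemma multilinear1 (f : nfun A 1) :
  multilinear f -> linear (fun x => f (args 1 [:: x])).
Proof.
(* The empty list stands for a placeholder 0 in the slot that is overwritten. *)
move=> f_lin k x y; have := f_lin (args 1 [::]) ord0 k x y.
by congr (f _ = _ *: f _ + f _); apply/ffunP => j; rewrite !ffunE (ord1 j).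
Qed.

Lemma multilinear2_bilinear (f : nfun A 2) :
  multilinear f -> is_bilinear (fun x y => f (args 2 [:: x; y])).
Proof.
move=> f_lin; split=> [y|x] k u v.
  have := f_lin (args 2 [:: 0; y]) ord0 k u v.
  by congr (f _ = _ *: f _ + f _); apply/ffunP => -[[|[|//]] Hl];
    rewrite !ffunE.
have := f_lin (args 2 [:: x; 0]) ord_max k u v.
by congr (f _ = _ *: f _ + f _); apply/ffunP => -[[|[|//]] Hl];
  rewrite !ffunE.
Qed.

End LowDegree.

(** * The obstruction cocycle *)

Section Obstruction.

Variables (K : fieldType) (A : lmodType K) (N n : nat).
Variables (mu : A -> A -> A) (d : 'I_N -> A -> A).
Variables (mut : 'I_n.+1 -> A -> A -> A) (dt : 'I_N -> 'I_n.+1 -> A -> A).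
Hypotheses (AssHDer_A : AssHDer_pair mu d).
Hypothesis (def : deformation mu d mut dt).

Let mu_bilinear : is_bilinear mu := mul_bilinear AssHDer_A.

(** The product and the maps with prescribed coefficients of t^(n+1); they need not form a
    deformation. *)
Let extm v := tmul (extend mut v).
Let extD e k := tmap (extend (dt k) (e k)).

Section AnyExtension.

Variables (v : A -> A -> A) (e : 'I_N -> A -> A).
Hypotheses (v_bilinear : is_bilinear v) (e_linear : forall k, linear (e k)).

Lemma extend_bilinear i : is_bilinear (extend mut v i).
Proof. by apply: extend_ind => // j; apply: def_mul_bilinear def j. Qed.

Lemma extend_linear k i : linear (extend (dt k) (e k) i).
Proof. by apply: extend_ind => // j; apply: def_der_linear def k j. Qed.

Lemma extm_bilinear : is_bilinear (extm v).
Proof. exact: tmul_bilinear extend_bilinear. Qed.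

Lemma extD_linear k : linear (extD e k).
Proof. exact: tmap_linear (extend_linear k). Qed.

Lemma extm0 x y : extm v x y ord0 = mu (x ord0) (y ord0).
Proof. by rewrite tmul0E extend0 (def_mul0 def). Qed.

Lemma der0_extD0 i x : der0 (extD e) i x ord0 = der0 d i (x ord0).
Proof.
case: (unliftP ord0 i) => [k|] ->; rewrite ?der0_lift ?der0_0 //.
by rewrite tmap0E extend0 (def_der0 def).
Qed.

Lemma extm_max_l x y :
  trunc x = 0 -> extm v x y ord_max = mu (x ord_max) (y ord0).
Proof.
move=> x0; rewrite tmul_max_l ?extend0 ?(def_mul0 def) // => i a.
exact: linear_at0 ((extend_bilinear i).1 a).
Qed.

Lemma extm_max_r x y :
  trunc y = 0 -> extm v x y ord_max = mu (x ord0) (y ord_max).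
Proof.
move=> y0; rewrite tmul_max_r ?extend0 ?(def_mul0 def) // => i a.
exact: linear_at0 ((extend_bilinear i).2 a).
Qed.

Lemma der0_extD_max i x :
  trunc x = 0 -> der0 (extD e) i x ord_max = der0 d i (x ord_max).
Proof.
move=> x0; case: (unliftP ord0 i) => [k|] ->; rewrite ?der0_lift ?der0_0 //.
rewrite tmap_max ?extend0 ?(def_der0 def) // => j.
exact: linear_at0 (extend_linear k j).
Qed.

(** Truncation forgets [v] and leaves the associator of the given deformation, which is zero. *)
Lemma trunc_associator x y z : trunc (associator (extm v) x y z) = 0.
Proof.
rewrite /associator raddfB /= !trunc_tmul.
by rewrite (mul_assoc (def_pair def)) subrr.
Qed.

Lemma trunc_der0 i x :
  trunc (der0 (extD e) i x) = der0 (fun k => tmap (dt k)) i (trunc x).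
Proof.
case: (unliftP ord0 i) => [k|] ->; rewrite ?der0_lift ?der0_0 //.
by rewrite trunc_tmap.
Qed.

Lemma trunc_leib i x y : trunc (leib (extm v) (extD e) i x y) = 0.
Proof.
case: (unliftP ord0 i) => [k|] ->; last by rewrite leib0 raddf0.
rewrite /leib raddfB raddf_sum /= trunc_der0 trunc_tmul der0_lift.
rewrite (der_mul (def_pair def)); apply/eqP; rewrite subr_eq0; apply/eqP.
by apply: eq_bigr => p _; rewrite trunc_tmul !trunc_der0.
Qed.

(** Constant arguments lose nothing: [associator_max] recovers the top coefficient of every
    associator from these values, and [leib_max] does the same for [obs_der]. *)
Definition obs_ass a b c :=
  associator (extm v) (tconst n a) (tconst n b) (tconst n c) ord_max.

Definition obs_der i a b :=
  leib (extm v) (extD e) i (tconst n a) (tconst n b) ord_max.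

(** The associator is linear in each argument with values in t^(n+1) A, so [top_linear_const]
    replaces the arguments by their constant terms one at a time. *)
Lemma associator_max x y z :
  associator (extm v) x y z ord_max = obs_ass (x ord0) (y ord0) (z ord0).
Proof.
have lin_l := associator_linear_l extm_bilinear.
have lin_m := associator_linear_m extm_bilinear.
have lin_r := associator_linear_r extm_bilinear.
rewrite (top_linear_const _ (lin_l y z)); last first.
  by move=> ?; exact: trunc_associator.
rewrite (top_linear_const _ (lin_m _ z)); last first.
  by move=> ?; exact: trunc_associator.
by rewrite (top_linear_const _ (lin_r _ _)) // => ?; exact: trunc_associator.
Qed.

Lemma leib_max i x y :
  leib (extm v) (extD e) i x y ord_max = obs_der i (x ord0) (y ord0).
Proof.
have lin_l := leib_linear_l extm_bilinear extD_linear.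
have lin_r := leib_linear_r extm_bilinear extD_linear.
rewrite (top_linear_const _ (lin_l i y)); last by move=> ?; exact: trunc_leib.
by rewrite (top_linear_const _ (lin_r i _)) // => ?; exact: trunc_leib.
Qed.

(** The top coefficient of the pentagon identity. Outer products reduce to [mu] because associators
    lie in t^(n+1) A; of an inner product only the constant term, given by [mu], counts. *)
Lemma obs_ass_cocycle a b c t :
  mu a (obs_ass b c t) - obs_ass (mu a b) c t + obs_ass a (mu b c) t
  - obs_ass a b (mu c t) + mu (obs_ass a b c) t = 0.
Proof.
have /ffunP/(_ ord_max) := associator_pentagon extm_bilinear (tconst n a)
  (tconst n b) (tconst n c) (tconst n t).
rewrite tcoefD tcoef_BDB tcoef0.
rewrite (extm_max_l _ (trunc_associator _ _ _)).
rewrite (extm_max_r _ (trunc_associator _ _ _)).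
by rewrite !associator_max !extm0 !tconst0.
Qed.

(** The top coefficient of [leib_associator], where by the same reductions only [mu] and [d] survive
    outside the defects. *)
Lemma obs_der_cocycle (i : 'I_N.+1) a b c :
  \sum_(p : 'I_N.+1 * 'I_N.+1 | (p.1 + p.2)%N == i)
     mu (der0 d p.1 a) (obs_der p.2 b c)
  - obs_der i (mu a b) c + obs_der i a (mu b c)
  - \sum_(p : 'I_N.+1 * 'I_N.+1 | (p.1 + p.2)%N == i)
      mu (obs_der p.1 a b) (der0 d p.2 c)
  = \sum_(j : 'I_N.+1) \sum_(p : 'I_N.+1 * 'I_N.+1 | (j + (p.1 + p.2))%N == i)
       obs_ass (der0 d j a) (der0 d p.1 b) (der0 d p.2 c)
    - der0 d i (obs_ass a b c).
Proof.
have /ffunP/(_ ord_max) E := leib_associator extm_bilinear extD_linear i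
  (tconst n a) (tconst n b) (tconst n c).
rewrite tcoef_BDB [RHS]tcoefB 3!tcoef_sum !leib_max !extm0 !tconst0 in E.
rewrite (der0_extD_max _ (trunc_associator _ _ _)) in E.
rewrite -/(obs_ass a b c) in E.
move: E; congr (_ - _ + _ - _ = _ - _); apply: eq_bigr => p _.
- rewrite (extm_max_r _ (trunc_leib _ _ _)) leib_max.
  by rewrite der0_extD0 !tconst0.
- rewrite (extm_max_l _ (trunc_leib _ _ _)) leib_max.
  by rewrite der0_extD0 !tconst0.
rewrite tcoef_sum; apply: eq_bigr => q _.
by rewrite associator_max !der0_extD0 !tconst0.
Qed.

End AnyExtension.

(** * The obstruction of the extension by zero *)

Let zero2 : A -> A -> A := fun _ _ => 0.
Let zero1 : 'I_N -> A -> A := fun _ _ => 0.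

Lemma zero2_bilinear : is_bilinear zero2.
Proof. by split=> ? ? ? ?; rewrite /zero2 /= scaler0 addr0. Qed.

Lemma zero1_linear k : linear (zero1 k).
Proof. by move=> ? ? ?; rewrite /zero1 /= scaler0 addr0. Qed.

Definition obstruction : precochain A N 3 :=
  (fun a : {ffun 'I_3 -> A} =>
     obs_ass zero2 (a ord0) (a (lift ord0 ord0)) (a ord_max),
   fun (k : 'I_N) (a : {ffun 'I_2 -> A}) =>
     obs_der zero2 zero1 (lift ord0 k) (a ord0) (a ord_max)).

Lemma obstruction_cochain : cochain obstruction.
Proof.
have bil := extm_bilinear zero2_bilinear.
have lin := extD_linear zero1_linear.
split=> [a i|k a i] c x y /=; rewrite !ffunE -!val_eqE /=.
  case: i => -[|[|[|//]]] Hi /=.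
  - exact: (top_const_linear (associator_linear_l bil _ _)).
  - exact: (top_const_linear (associator_linear_m bil _ _)).
  - exact: (top_const_linear (associator_linear_r bil _ _)).
case: i => -[|[|//]] Hi /=.
- exact: (top_const_linear (leib_linear_l bil lin _ _)).
- exact: (top_const_linear (leib_linear_r bil lin _ _)).
Qed.

Lemma obstruction_cocycle : cocycle mu d obstruction.
Proof.
split; first exact: obstruction_cochain.
split=> [a|k a] /=.
  have [s] := argsP a; case: s => [|x [|y [|z [|t [|//]]]]] // _ ->.
  rewrite delta_Hoch3E !ffunE /=.
  exact: obs_ass_cocycle zero2_bilinear _ _ _ _.
have [s] := argsP a; case: s => [|x [|y [|z [|//]]]] // _ ->.
(* The defects, indexed from 0, serve as the padded family thanks to [leib0]. *)
rewrite (@delta'_Hoch2E _ _ _ _ _ mu_bilinear _ (obs_der zero2 zero1));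
  first last.
- by move=> j b c; rewrite !ffunE.
- by move=> b c; rewrite /obs_der leib0 ffunE.
rewrite delta3E !ffunE /=.
have := obs_der_cocycle zero2_bilinear zero1_linear (lift ord0 k) x y z.
rewrite lift0 => ->.
(* Here [delta] carries the sign (-1)^3, so the differential is the difference of the two sides just
   equated. *)
rewrite der0_lift !exprS expr0 !mulN1r opprK scaleN1r.
under [X in _ - (X - _)]eq_bigr do under eq_bigr do rewrite !ffunE /=.
by rewrite subrr.
Qed.

(** * Effect of the coefficients of t^(n+1) on the obstruction *)

Section Extension.

Variables (v : A -> A -> A) (e : 'I_N -> A -> A).
Hypotheses (v_bilinear : is_bilinear v) (e_linear : forall k, linear (e k)).

(** The subtracted bracket is the Hochschild coboundary of [v] in the form of [delta_Hoch2E]: [v]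
    enters once through each of the four products, on constant terms only. *)
Lemma associator_extend x y z :
  associator (extm v) x y z ord_max =
  obs_ass zero2 (x ord0) (y ord0) (z ord0)
  - (mu (x ord0) (v (y ord0) (z ord0)) - v (mu (x ord0) (y ord0)) (z ord0)
     + v (x ord0) (mu (y ord0) (z ord0)) - mu (v (x ord0) (y ord0)) (z ord0)).
Proof.
have bil := extm_bilinear zero2_bilinear.
have addl y' := linear_atD (bil.1 y').
have addr x' := linear_atD (bil.2 x').
rewrite -(associator_max zero2_bilinear) /associator !tcoefB.
rewrite /extm [tmul (extend mut v) (tmul _ _ _) _]tmul_extend.
rewrite [tmul (extend mut v) x (tmul _ _ _)]tmul_extend.
rewrite [tmul (extend mut v) x y]tmul_extend.
rewrite [tmul (extend mut v) y z]tmul_extend.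
rewrite -!/zero2 -!/(extm zero2) addl addr !tcoefD !ttop_max.
rewrite !ttop0 !addr0 (extm_max_l zero2_bilinear _ (trunc_ttop _ _))
  (extm_max_r zero2_bilinear _ (trunc_ttop _ _)).
rewrite !ttop_max !extm0 !opprD !opprK !addrA.
by rewrite [LHS](ACl (1*4*5*3*6*2)).
Qed.

(** The first-order variation of a product; the term in both [a] and [b] disappears because
    [ttop n b] has no constant term. *)
Lemma extm_perturb x y a b :
  extm v (x + ttop n a) (y + ttop n b) ord_max =
  extm zero2 x y ord_max
  + (mu (x ord0) b + mu a (y ord0) + v (x ord0) (y ord0)).
Proof.
have bil := extm_bilinear zero2_bilinear.
rewrite /extm tmul_extend -!/zero2 -!/(extm zero2).
rewrite (linear_atD (bil.1 _)) (linear_atD (bil.2 _)) !tcoefD !ttop_max !ttop0.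
rewrite !addr0 (extm_max_r zero2_bilinear _ (trunc_ttop _ _))
  (extm_max_l zero2_bilinear _ (trunc_ttop _ _)).
by rewrite tcoefD !ttop_max ttop0 addr0 !addrA.
Qed.

(** Zero at index 0, since the identity d_0 is not deformed; this is the padded family [g] of
    [delta'_Hoch1E]. *)
Definition der_extend (i : 'I_N.+1) (a : A) : A :=
  if unlift ord0 i is Some k then e k a else 0.

Lemma der_extend0 a : der_extend ord0 a = 0.
Proof. by rewrite /der_extend unlift_none. Qed.

Lemma der_extend_lift k a : der_extend (lift ord0 k) a = e k a.
Proof. by rewrite /der_extend liftK. Qed.

Lemma der0_extend i x :
  der0 (extD e) i x = der0 (extD zero1) i x + ttop n (der_extend i (x ord0)).
Proof.
rewrite /der_extend; case: (unliftP ord0 i) => [k|] ->.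
  by rewrite !der0_lift /extD tmap_extend.
rewrite !der0_0 (tseries_split (x := ttop n 0)) ?trunc_ttop ?ttop_max //.
by rewrite addr0.
Qed.

(** The subtracted term is [delta'_Hoch] of [e] plus [delta] of [v], hence a component of the
    differential of the 2-cochain formed by [v] and [e]. *)
Lemma leib_extend (k : 'I_N) (x y : tseries A n.+1) (a := x ord0)
    (b := y ord0) (s := fun F : 'I_N.+1 -> 'I_N.+1 -> A =>
    \sum_(p : 'I_N.+1 * 'I_N.+1 | (p.1 + p.2)%N == k.+1) F p.1 p.2) :
  leib (extm v) (extD e) (lift ord0 k) x y ord_max =
  obs_der zero2 zero1 (lift ord0 k) a b
  - (s (fun i j => mu (der0 d i a) (der_extend j b)) - e k (mu a b)
     + s (fun i j => mu (der_extend i a) (der0 d j b))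
     + (s (fun i j => v (der0 d i a) (der0 d j b)) - d k (v a b))).
Proof.
have lin := extD_linear zero1_linear.
rewrite -(leib_max zero2_bilinear zero1_linear) /leib !tcoefB !tcoef_sum lift0.
have -> : \sum_(p : 'I_N.+1 * 'I_N.+1 | (p.1 + p.2)%N == k.+1)
    extm v (der0 (extD e) p.1 x) (der0 (extD e) p.2 y) ord_max =
  \sum_(p : 'I_N.+1 * 'I_N.+1 | (p.1 + p.2)%N == k.+1)
     extm zero2 (der0 (extD zero1) p.1 x) (der0 (extD zero1) p.2 y) ord_max
  + (s (fun i j => mu (der0 d i a) (der_extend j b))
     + s (fun i j => mu (der_extend i a) (der0 d j b))
     + s (fun i j => v (der0 d i a) (der0 d j b))).
  rewrite /s -!big_split /=; apply: eq_bigr => p _.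
  by rewrite !der0_extend extm_perturb !der0_extD0.
rewrite der0_extend extm0 -/a -/b.
rewrite {1}/extm [tmul (extend mut v) x y]tmul_extend -!/zero2 -!/(extm zero2).
rewrite (linear_atD (linear_der0 lin _)) !tcoefD !ttop_max.
rewrite (der0_extD_max zero1_linear _ (trunc_ttop _ _)) ttop_max !der0_lift.
rewrite der_extend_lift !opprD !opprK !addrA.
by rewrite [LHS](ACl (1*4*5*3*6*7*2)).
Qed.

End Extension.

Lemma vanishing_extensible :
  coboundary mu d (n := 3) obstruction -> extensible mu d mut dt.
Proof.
case=> -[b1 b2] [[b1_lin b2_lin] [/= ass der]].
(* The new coefficients are the 2-cochain whose differential is the obstruction: [associator_extend]
   and [leib_extend] subtract exactly that differential. *)
pose v x y := b1 (args 2 [:: x; y]).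
pose e k x := b2 k (args 1 [:: x]).
have v_bilinear : is_bilinear v by exact: multilinear2_bilinear.
have e_linear k : linear (e k) by exact: multilinear1.
exists v, e; split=> //; split.
- exact: extend_bilinear.
- exact: extend_linear.
- by move=> x y; rewrite extend0 (def_mul0 def).
- by move=> k x; rewrite extend0 (def_der0 def).
split.
- exact: extm_bilinear.
- move=> x y z; apply/esym/eqP; rewrite -subr_eq0; apply/eqP.
  apply: tseries_split (trunc_associator v x y z) _.
  rewrite associator_extend; have := ass (args 3 [:: x ord0; y ord0; z ord0]).
  by rewrite delta_Hoch2E !ffunE /= => ->; rewrite subrr.
- exact: extD_linear.
move=> k x y; apply/eqP; rewrite -subr_eq0; apply/eqP.
have := tseries_split (trunc_leib v e (lift ord0 k) x y).
rewrite leib_extend; have := der k (args 2 [:: x ord0; y ord0]).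
rewrite (@delta'_Hoch1E _ _ _ _ _ mu_bilinear _ (der_extend e)); first last.
- by move=> j a; rewrite der_extend_lift.
- by move=> a; rewrite der_extend0.
(* In degree 2 the sign of [delta] is (-1)^2 = 1, which matches [leib_extend]. *)
rewrite delta2E !ffunE /= expr2 mulN1r opprK scale1r => ->.
rewrite subrr => /(_ erefl); rewrite /leib der0_lift lift0; exact.
Qed.

End Obstruction.

Theorem theorem6p9 (K : fieldType) (charK : [pchar K] =i pred0)
    (N : nat) (N_ge1 : (1 <= N)%N) (A : lmodType K)
    (mu : A -> A -> A) (d : 'I_N -> A -> A)
    (AssHDer_A : AssHDer_pair mu d)
    (H3_eq0 : cohomology_vanishes mu d 3) :
  forall (n : nat) (mut : 'I_n.+1 -> A -> A -> A)
         (dt : 'I_N -> 'I_n.+1 -> A -> A),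
    deformation mu d mut dt -> extensible mu d mut dt.
Proof.
move=> n mut dt def; apply: (vanishing_extensible AssHDer_A def).
exact: H3_eq0 (obstruction_cocycle AssHDer_A def).
Qed.
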